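(* Let $k\ge1$ and let $x\in\tilde S_{k+1}$ be an affine permutation. The four $k$-codes of $x$ equal the four affine codes of $x$; that is, for every $i\in\{0,1,\dots,k\}$: $$\mathrm{RD}(x)_i=\#\{j\in\mathbb Z: j<i+1,\ x(j)>x(i+1)\},$$ $$\mathrm{RI}(x)_i=\#\{j\in\mathbb Z: j>i,\ x(j)<x(i)\},$$ $$\mathrm{LD}(x)_i=\#\{j\in\mathbb Z: j<x^{-1}(i),\ x(j)>i\},$$ $$\mathrm{LI}(x)_i=\#\{j\in\mathbb Z: j>x^{-1}(i+1),\ x(j)<i+1\}.$$
   Context: Fix $k\ge1$, $I=\mathbb Z/(k+1)\mathbb Z=\{0,\dots,k\}$. $\tilde S_{k+1}$ is the group of bijections $x:\mathbb Z\to\mathbb Z$ with $x(i+k+1)=x(i)+k+1$ and $\sum_{i=1}^{k+1}x(i)=\binom{k+2}{2}$; $s_i$ ($i\in I$) exchanges $m(k+1)+i$ and $m(k+1)+i+1$ for all $m\in\mathbb Z$; products are compositions of functions, so right multiplication by $s_i$ acts on positions and left multiplication on values. The affine nil-Coxeter monoid is generated by $a_i$ ($i\in I$) and an absorbing zero, with relations $a_i^2=0$, $a_ia_j=a_ja_i$ for $j\notin\{i-1,i,i+1\}$, and (for $k\ge2$) $a_ia_{i+1}a_i=a_{i+1}a_ia_{i+1}$; its nonzero elements are identified with affine permutations by $a_{w_1}\cdots a_{w_l}\leftrightarrow s_{w_1}\cdots s_{w_l}$ for reduced words. For $A\subsetneq I$, $d_A$ (resp. $u_A$) is the product of the $a_i$,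 $i\in A$, each once, with $a_j$ to the left (resp. right) of $a_{j-1}$ whenever $j,j-1\in A$. For an affine permutation $x$ there are four canonical decompositions into nonempty proper subsets of $I$, each unique: right decreasing: $x=d_{A_n}\cdots d_{A_1}$ with $(|A_1|,\dots,|A_n|)$ lexicographically maximal; right increasing: $x=u_{B_m}\cdots u_{B_1}$ with $(|B_1|,\dots,|B_m|)$ lexicographically maximal; left decreasing: $x=d_{C_1}\cdots d_{C_r}$ with $(|C_1|,\dots,|C_r|)$ lexicographically maximal; left increasing: $x=u_{E_1}\cdots u_{E_t}$ with $(|E_1|,\dots,|E_t|)$ lexicographically maximal. The associated $k$-codes are $\mathrm{RD}(x)_i=\#\{j\ge 1: i-(j-1)\in A_j\}$, $\mathrm{RI}(x)_i=\#\{j\ge1: i+(j-1)\in B_j\}$, $\mathrm{LD}(x)_i=\#\{j\ge1: i+(j-1)\in C_j\}$, $\mathrm{LI}(x)_i=\#\{j\ge1: i-(j-1)\in E_j\}$, for $i\in I$. *)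

(* Defs.v *)
(* MathComp, with mathcomp-classical for the choice operator [xget] and the
   cardinality relation [#=] on sets of integers. *)
From mathcomp Require Import all_boot all_order all_algebra.
From mathcomp Require Import boolp classical_sets functions cardinality.

Set Implicit Arguments.
Unset Strict Implicit.
Unset Printing Implicit Defensive.

Import Order.TTheory GRing.Theory Num.Theory.
Local Open Scope ring_scope.

(* The index set I = Z/(k+1)Z is 'I_k.+1; i + 1 and i - 1 in I are the cyclic
   [ordS i] and [ord_pred i]. *)

Record affine_perm (k : nat) := AffinePerm {
  ap_fun :> int -> int;
  ap_inv : int -> int;
  ap_funK : cancel ap_fun ap_inv;
  ap_invK : cancel ap_inv ap_fun;
  ap_shift : forall z : int, ap_fun (z + (k.+1)%:Z) = ap_fun z + (k.+1)%:Z;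
  ap_sum : \sum_(1 <= j < k.+2) ap_fun j%:Z = ('C(k.+2, 2))%:Z
}.

Definition simple_refl (k : nat) (i : 'I_k.+1) (z : int) : int :=
  if (z == i%:Z %[mod (k.+1)%:Z])%Z then z + 1
  else if (z == i%:Z + 1 %[mod (k.+1)%:Z])%Z then z - 1
  else z.

(* s_{w_1} \o ... \o s_{w_l} *)
Definition word_perm (k : nat) (w : seq 'I_k.+1) : int -> int :=
  foldr (fun i f => simple_refl i \o f) id w.

Definition reduced (k : nat) (w : seq 'I_k.+1) : Prop :=
  forall v : seq 'I_k.+1, word_perm v =1 word_perm w -> (size w <= size v)%N.

(* The affine nil-Coxeter monoid, by its presentation: [Some w] stands for
   a_{w_1} ... a_{w_l}, [None] for the absorbing zero, and [nilcox] is the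
   congruence generated by the defining relations. Since p . 0 . q is [None],
   closing the relations under word contexts makes [nilcox] a congruence. *)
Inductive nilcox (k : nat) :
    option (seq 'I_k.+1) -> option (seq 'I_k.+1) -> Prop :=
| nilcox_refl m : nilcox m m
| nilcox_sym m1 m2 : nilcox m1 m2 -> nilcox m2 m1
| nilcox_trans m1 m2 m3 : nilcox m1 m2 -> nilcox m2 m3 -> nilcox m1 m3
| nilcox_square p q i : nilcox (Some (p ++ [:: i; i] ++ q)) None
| nilcox_comm p q i j :
    j \notin [:: ord_pred i; i; ordS i] ->
    nilcox (Some (p ++ [:: i; j] ++ q)) (Some (p ++ [:: j; i] ++ q))
| nilcox_braid p q i :
    (2 <= k)%N ->
    nilcox (Some (p ++ [:: i; ordS i; i] ++ q))
           (Some (p ++ [:: ordS i; i; ordS i] ++ q)).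

(* The monoid element [m] is identified with the affine permutation [x]. *)
Definition represents (k : nat) (m : option (seq 'I_k.+1)) (x : affine_perm k)
    : Prop :=
  exists w, [/\ reduced w, x =1 word_perm w & nilcox m (Some w)].

(* [w] is an admissible order of the factors a_i (i in A) in the product d_A:
   each once, a_j to the left of a_{j-1}. All such [w] are equal in the
   monoid when A is a proper subset of I. *)
Definition dec_word (k : nat) (A : {set 'I_k.+1}) (w : seq 'I_k.+1) : bool :=
  [&& uniq w, [set i in w] == A &
      [forall j in A, (ord_pred j \in A) ==>
                      (index j w < index (ord_pred j) w)%N]].

(* Same for u_A: a_j to the right of a_{j-1}. *)
Definition inc_word (k : nat) (A : {set 'I_k.+1}) (w : seq 'I_k.+1) : bool :=
  [&& uniq w, [set i in w] == A &
      [forall j in A, (ord_pred j \in A) ==>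
                      (index (ord_pred j) w < index j w)%N]].

Definition nonempty_proper (k : nat) (A : {set 'I_k.+1}) : bool :=
  (A != finset.set0) && (A \proper [set: 'I_k.+1]).

(* With [P := dec_word]: x = d_{X_1} d_{X_2} ... d_{X_n}, in this order, where
   [Xs = [:: X_1; ...; X_n]]; similarly for u with [P := inc_word]. *)
Definition decomposition (k : nat) (P : {set 'I_k.+1} -> seq 'I_k.+1 -> bool)
    (x : affine_perm k) (Xs : seq {set 'I_k.+1}) : Prop :=
  all (@nonempty_proper k) Xs /\
  exists2 ws, all2 P Xs ws & represents (Some (flatten ws)) x.

Definition card_seq (k : nat) (Xs : seq {set 'I_k.+1}) : seqlexi nat :=
  [seq #|(X : {set 'I_k.+1})| | X <- Xs].

Definition lex_max (k : nat) (Q : seq {set 'I_k.+1} -> Prop)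
    (Xs : seq {set 'I_k.+1}) : Prop :=
  Q Xs /\ forall Ys, Q Ys -> (card_seq Ys <= card_seq Xs)%O.

(* The canonical decompositions, listed from index 1 upwards; for the right
   ones the product is read from the last index down to the first. Each exists
   and is unique, so the choice operator returns it. *)
Definition rd_decomp (k : nat) (x : affine_perm k) : seq {set 'I_k.+1} :=
  xget [::] (lex_max (fun As => decomposition (@dec_word k) x (rev As))).

Definition ri_decomp (k : nat) (x : affine_perm k) : seq {set 'I_k.+1} :=
  xget [::] (lex_max (fun Bs => decomposition (@inc_word k) x (rev Bs))).

Definition ld_decomp (k : nat) (x : affine_perm k) : seq {set 'I_k.+1} :=
  xget [::] (lex_max (decomposition (@dec_word k) x)).

Definition li_decomp (k : nat) (x : affine_perm k) : seq {set 'I_k.+1} :=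
  xget [::] (lex_max (decomposition (@inc_word k) x)).

(* [down_code Xs i] = #{j >= 1 : i - (j-1) in X_j}, with 0-based [j] below;
   [up_code Xs i] = #{j >= 1 : i + (j-1) in X_j}. *)
Definition down_code (k : nat) (Xs : seq {set 'I_k.+1}) (i : 'I_k.+1) : nat :=
  #|[set j : 'I_(size Xs) | iter j (@ord_pred _) i \in nth finset.set0 Xs j]|.

Definition up_code (k : nat) (Xs : seq {set 'I_k.+1}) (i : 'I_k.+1) : nat :=
  #|[set j : 'I_(size Xs) | iter j (@ordS _) i \in nth finset.set0 Xs j]|.

Definition RD (k : nat) (x : affine_perm k) : 'I_k.+1 -> nat :=
  down_code (rd_decomp x).
Definition RI (k : nat) (x : affine_perm k) : 'I_k.+1 -> nat :=
  up_code (ri_decomp x).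
Definition LD (k : nat) (x : affine_perm k) : 'I_k.+1 -> nat :=
  up_code (ld_decomp x).
Definition LI (k : nat) (x : affine_perm k) : 'I_k.+1 -> nat :=
  down_code (li_decomp x).

(* Main.v *)
(* Cancelling a letter s_i on the right of a permutation (at a descent) acts on
   its affine code c by moving c_i - 1 to the neighbour of i and moving the
   neighbour's entry to i, and s_i is a descent exactly when c_i exceeds that
   neighbour. So reduced words of a permutation are the sequences of such moves
   that bring its code to zero, and the problem becomes one on vectors c.  If
   cancelling a cyclically decreasing product d_B is possible, then B lies in
   the support A of c: a letter of B still has its original entry c_i when its
   turn comes, and this entry exceeds another one. Cancelling d_A itself is
   possible and turns c into the vector with c_i - 1 (or 0) at the neighbour of
   i. Hence the lexicographically maximal decomposition is the greedy one, which
   removes supports, and its k-code is c by induction. The increasing case is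
   the mirror image, and the left decompositions are those of the inverse
   permutation. *)
Require Import Defs.
From mathcomp Require Import all_boot all_order all_algebra.
From mathcomp Require Import boolp classical_sets functions cardinality.
From mathcomp Require Import finmap zify.

Set Implicit Arguments.
Unset Strict Implicit.
Unset Printing Implicit Defensive.

Import Order.TTheory GRing.Theory Num.Theory.
Local Open Scope ring_scope.

(** * Codes and their greedy decomposition *)

Section Codes.
Variables (k : nat) (b : bool).
Local Notation I := 'I_k.+1.
Local Notation code := {ffun I -> nat}.

(* Both neighbour orientations are needed: RD and LI codes move from [i] to
   [i - 1], RI and LD codes from [i] to [i + 1]. *)
Definition prv : I -> I := if b then @ord_pred k.+1 else @ordS k.+1.
Definition nxt : I -> I := if b then @ordS k.+1 else @ord_pred k.+1.

Lemma prvK : cancel prv nxt.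
Proof. by rewrite /prv /nxt; case: b; [exact: ord_predK | exact: ordSK]. Qed.

Lemma nxtK : cancel nxt prv.
Proof. by rewrite /prv /nxt; case: b; [exact: ordSK | exact: ord_predK]. Qed.

(* Effect on the code of a permutation of cancelling a letter [i] that is a
   descent, i.e. such that [c (prv i) < c i]. *)
Definition peel1 (i : I) (c : code) : option code :=
  if (c (prv i) < c i)%N then
    Some [ffun j => if j == i then c (prv i)
                    else if j == prv i then (c i).-1 else c j]
  else None.

(** The head of [r] is cancelled first, so [r] spells a reduced word from its right end; [None]
    means that some letter was not a descent when its turn came. *)
Definition peel (r : seq I) (c : code) : option code :=
  foldl (fun o i => obind (peel1 i) o) (Some c) r.

Lemma peel_cat r s c : peel (r ++ s) c = obind (peel s) (peel r c).
Proof.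
rewrite /peel foldl_cat; case: (foldl _ _ r) => //=.
by elim: s.
Qed.

Lemma peel_cons i s c : peel (i :: s) c = obind (peel s) (peel1 i c).
Proof. by rewrite -cat1s peel_cat. Qed.

Lemma peel_rcons s i c : peel (rcons s i) c = obind (peel1 i) (peel s c).
Proof. by rewrite -cats1 peel_cat /=; case: (peel s c). Qed.

Lemma peel1_sum i c c' :
  peel1 i c = Some c' -> (\sum_j c j = (\sum_j c' j).+1)%N.
Proof.
rewrite /peel1; case: ltnP => // lt_c [<-].
have ne_pi : prv i != i by apply: contraTneq lt_c => ->; rewrite ltnn.
rewrite (bigD1 i) // [in RHS](bigD1 i) //= (bigD1 (prv i)) //=.
rewrite [in RHS](bigD1 (prv i)) //= !ffunE !eqxx (negPf ne_pi).
under [in RHS]eq_bigr => j /andP[/negPf nji /negPf njp] do rewrite ffunE nji njp.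
lia.
Qed.

Lemma peel_sum r c c' :
  peel r c = Some c' -> (\sum_j c j = \sum_j c' j + size r)%N.
Proof.
elim: r c => [|i r IHr] c; first by rewrite /peel /= addn0 => -[->].
rewrite peel_cons; case E: (peel1 i c) => [d|] //= /IHr.
by rewrite (peel1_sum E) => ->; rewrite addnS.
Qed.

(** The order in which the letters of a cyclic product are cancelled. For [b = true] this is
    [inc_word], the reverse of [dec_word]; for [b = false] it is [dec_word]. *)
Definition removal (A : {set I}) (v : seq I) : bool :=
  [&& uniq v, [set i in v] == A &
      [forall j in A, (prv j \in A) ==> (index (prv j) v < index j v)%N]].

Lemma removalP (A : {set I}) v :
  reflect [/\ uniq v, v =i A & {in A, forall j, prv j \in A ->
             (index (prv j) v < index j v)%N}]
          (removal A v).
Proof.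
apply: (iffP and3P) => [[Uv /eqP defA /forall_inP Hv]|[Uv defA Hv]].
  split=> // [i|j Aj Apj]; first by rewrite -defA inE.
  exact: (implyP (Hv j Aj)).
split=> //; first by apply/eqP/setP=> i; rewrite inE defA.
by apply/forall_inP => j Aj; apply/implyP; exact: Hv.
Qed.

(** Each positive entry meets a zero at its turn: its neighbour [prv i] either lies outside the
    support or was peeled earlier and left a zero behind. So every letter is a descent and its entry
    moves on, decreased by one. *)
Lemma peel_support (A : {set I}) v (c : code) :
    (forall i, (i \in A) = (0 < c i)%N) -> removal A v ->
  peel v c = Some [ffun i => (c (nxt i)).-1].
Proof.
move=> supp /removalP[Uv memv ordv].
(* A peeled letter has moved its entry one step; the entry it displaced is 0. *)
suff H p q : v = p ++ q -> peel p c = Some [ffun i =>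
    if nxt i \in p then (c (nxt i)).-1 else if i \in p then 0%N else c i].
  rewrite (H v [::]) ?cats0 //; congr Some; apply/ffunP=> i; rewrite !ffunE.
  rewrite !memv !supp; case: (c (nxt i)) => [|m] //=.
  by case: (c i).
elim/last_ind: p q => [|p i IHp] q defv.
  by congr Some; apply/ffunP=> i; rewrite ffunE.
rewrite cat_rcons in defv; rewrite peel_rcons (IHp (i :: q)) //=.
have Ai : i \in A by rewrite -memv defv mem_cat mem_head orbT.
have pN : i \notin p.
  by move: Uv; rewrite defv cat_uniq => /and3P[_ /norP[]].
have iv : index i v = size p by rewrite defv index_cat (negPf pN) /= eqxx addn0.
have before j : j \in v -> (j \in p) = (index j v < size p)%N.
  move=> jv; rewrite defv index_cat; case: ifP => [jp|_].
    by rewrite index_mem.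
  by rewrite ltnNge leq_addr.
(* Since [i = prv (nxt i)] must precede [nxt i], no entry has yet been moved onto position [i]. *)
have niN : nxt i \notin p.
  apply/negP => nip.
  have niv : nxt i \in v by rewrite defv mem_cat nip.
  have := ordv (nxt i); rewrite -memv nxtK iv => /(_ niv Ai).
  by move: nip; rewrite before //; lia.
have ci : (0 < c i)%N by rewrite -supp.
have prv0 : prv i \notin p -> c (prv i) = 0%N.
  move=> pip; apply/eqP; rewrite -leqn0 leqNgt -supp; apply/negP => Api.
  move: pip; rewrite before ?memv //.
  by have := ordv i Ai Api; rewrite iv => ->.
rewrite /peel1 !ffunE prvK (negPf pN) (negPf niN).
set c0 := if prv i \in p then 0%N else c (prv i).
have -> : c0 = 0%N by rewrite /c0; case: ifPn => // /prv0.
rewrite ci; congr Some; apply/ffunP => j; rewrite !ffunE !mem_rcons !inE.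
case: (eqVneq j i) => [->|nji].
  rewrite (negPf niN) orbF; case: eqVneq => // ni.
  have pi : prv i = i by rewrite -{1}ni nxtK.
  by have := ordv i Ai; rewrite pi ltnn => /(_ Ai).
rewrite -(can2_eq nxtK prvK).
by case: (eqVneq (nxt j) i) => // ->.
Qed.

(** Peeling [i] changes only the entries at [i] and [prv i], and [prv i], if in [B], has been peeled
    before. Hence the letters still waiting keep their original entries. *)
Lemma peel_removal_sub (B : {set I}) v (c c' : code) :
  removal B v -> peel v c = Some c' -> {in B, forall i, 0 < c i}%N.
Proof.
move=> /removalP[Uv memv ordv].
suff H p q d : v = p ++ q -> peel p c = Some d ->
    {in p, forall j, 0 < c j}%N /\ {in q, d =1 c}.
  move=> peelv i; rewrite -memv.
  by have [H' _] := H v [::] c' (esym (cats0 v)) peelv; apply: H'.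
elim/last_ind: p q d => [|p i IHp] q d defv; first by case=> ->.
rewrite cat_rcons in defv; rewrite peel_rcons.
case E: (peel p c) => [d0|] //=; have [cp d0q] := IHp _ _ defv E.
rewrite /peel1; have d0i : d0 i = c i by rewrite d0q ?mem_head.
case: ifP => // lt_c [<-].
split=> [j|j jq]; first by rewrite mem_rcons inE => /predU1P[->|/cp//]; lia.
move: (Uv); rewrite defv cat_uniq /= => /and4P[_ /norP[ip /hasPn qp] iq _].
rewrite ffunE; case: eqVneq => [ji|_]; first by rewrite -ji jq in iq.
case: eqVneq => [jpi|_]; last by rewrite d0q // inE jq orbT.
have Bi : i \in B by rewrite -memv defv mem_cat mem_head orbT.
have Bpi : prv i \in B by rewrite -memv defv mem_cat inE -jpi jq !orbT.
have := ordv i Bi Bpi; rewrite defv !index_cat (negPf ip) -jpi (negPf (qp j jq)).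
by rewrite /= eqxx addn0 ltnNge leq_addr.
Qed.

Lemma nxt_closed_full (A : {set I}) i :
  i \in A -> {in A, forall j, nxt j \in A} -> A = [set: I].
Proof.
have closedS (B : {set I}) j :
    j \in B -> {in B, forall l, ordS l \in B} -> B = [set: I].
  move=> Bj clB; apply/setP=> l; rewrite inE.
  (* One full turn is added so that the natural subtraction does not truncate. *)
  suff -> : l = iter (l + k.+1 - j) (@ordS k.+1) j.
    by elim: (_ - _)%N => //= m; exact: clB.
  apply/val_inj; have iterE m : val (iter m (@ordS k.+1) j) = ((j + m) %% k.+1)%N.
    elim: m => [|m IHm]; first by rewrite addn0 modn_small.
    by rewrite iterS /= IHm -[in LHS]addn1 modnDml addn1 addnS.
  rewrite iterE subnKC; last by rewrite (leq_trans (ltnW (ltn_ord j))) ?leq_addl.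
  by rewrite modnDr modn_small.
rewrite /nxt; case: b => Ai clA; first exact: closedS Ai clA.
(* For the opposite orientation, the complement of [A] is closed under [ordS]; if nonempty it would
   be everything, which [i] excludes. *)
apply/eqP; rewrite -finset.subTset; apply/fintype.subsetP => j _.
apply: contraT => Aj; suff /setP/(_ i) : ~: A = [set: I] by rewrite !inE Ai.
apply: (closedS _ j) => [|l]; first by rewrite inE.
rewrite !inE; apply: contra => /clA.
by rewrite ordSK.
Qed.

(** A proper nonempty subset of the cycle has an element [i] with [nxt i] outside it. Nothing has to
    come after this [i], so it can be put last. *)
Lemma removal_exists (A : {set I}) : A \proper [set: I] -> exists v, removal A v.
Proof.
have [m] := ubnP #|A|; elim: m A => // m IHm A leA prA.
have [->|/set0Pn[i0 Ai0]] := eqVneq A finset.set0.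
  by exists [::]; apply/removalP; split=> // j; rewrite !inE.
have [i Ai niN] : exists2 i, i \in A & nxt i \notin A.
  apply/exists_inP; rewrite -[[exists _ in _, _]]negbK negb_exists_in.
  apply: contraL prA => /forall_inP clA.
  by rewrite (nxt_closed_full Ai0) ?fintype.properxx // => j /clA; rewrite negbK.
have [||v /removalP[Uv memv ordv]] := IHm (A :\ i).
- by rewrite (cardsD1 i A) Ai in leA.
- exact: sub_proper_trans (subD1set _ _) prA.
exists (rcons v i); apply/removalP; split=> [|j|j Aj Apj].
- by rewrite rcons_uniq memv !inE eqxx.
- by rewrite mem_rcons inE memv !inE; case: eqVneq => [->|].
have pji : prv j != i by apply: contraNneq niN => <-; rewrite prvK.
have pjv : prv j \in v by rewrite memv !inE pji Apj.
have iv : i \notin v by rewrite memv !inE eqxx.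
have [ji|ji] := eqVneq j i.
  rewrite -cats1 !index_cat pjv ji (negPf iv) /= eqxx addn0 -ji.
  by rewrite index_mem.
rewrite -cats1 !index_cat pjv.
have -> : j \in v by rewrite memv !inE ji.
by rewrite ordv // !inE ?pji ?ji.
Qed.

Definition decomposes (c : code) (As : seq {set I}) : Prop :=
  all (@nonempty_proper k) As /\
  exists2 vs, all2 removal As vs & peel (flatten vs) c = Some [ffun=> 0%N].

(* The common form of [down_code] and [up_code]. *)
Definition kcode (As : seq {set I}) (i : I) : nat :=
  #|[set j : 'I_(size As) | iter j prv i \in nth finset.set0 As j]|.

Lemma kcode_cons (A : {set I}) As i :
  kcode (A :: As) i = ((i \in A) + kcode As (prv i))%N.
Proof.
rewrite /kcode -!sum1dep_card big_mkcond big_ord_recl /= -big_mkcond /=.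
congr (_ + _)%N.
by apply: eq_bigl => j; rewrite /= -iterSr.
Qed.

(** The zero entry makes the support proper, and it survives the removal, shifted one step. A
    competitor starts with a subset of the support: a strict subset loses at once lexicographically,
    and equality leaves the same code for the induction. *)
Lemma greedy_decomposition (c : code) :
    (exists i, c i = 0%N) ->
  exists As, [/\ decomposes c As,
    forall Ys, decomposes c Ys -> Ys = As \/ (card_seq Ys < card_seq As)%O
    & kcode As =1 c].
Proof.
have [m] := ubnP (\sum_i c i)%N; elim: m c => // m IHm c ltm [i0 ci0].
have [c0|[i ci]] : c = [ffun=> 0%N] \/ exists i, (0 < c i)%N.
- case: (pickP (fun i => 0 < c i)%N) => [i ci|c0]; [by right; exists i | left].
  by apply/ffunP=> i; rewrite ffunE; apply/eqP; rewrite -leqn0 leqNgt c0.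
- exists [::]; rewrite c0; split; first by split=> //; exists [::].
    2: by move=> i; rewrite /kcode ffunE eq_card0 // => -[].
  case=> [|Y Ys]; [by left | case=> /= Yne [[|v vs] //= /andP[remv _]]].
  move=> peelv; exfalso.
  move: peelv; rewrite peel_cat; case E: (peel v _) => [d|] // _.
  case/andP: Yne => /andP[/set0Pn[i Yi] _] _.
  by have := peel_removal_sub remv E Yi; rewrite ffunE.
pose A : {set I} := [set i | (0 < c i)%N].
have supp j : (j \in A) = (0 < c j)%N by rewrite inE.
have propA : A \proper [set: I].
  rewrite finset.properT; apply/eqP=> /setP/(_ i0).
  by rewrite supp ci0 inE.
have [v remv] := removal_exists propA.
have peelv := peel_support supp remv.
set c1 := [ffun j => (c (nxt j)).-1] in peelv.
have [||As [decAs maxAs codeAs]] := IHm c1.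
- have := peel_sum peelv.
  have : (0 < size v)%N.
    have [_ memv _] := removalP _ _ remv.
    by have : i \in v; [rewrite memv supp | case: (v)].
  lia.
- by exists (prv i0); rewrite ffunE prvK ci0.
exists (A :: As); split; last first.
- move=> j; rewrite kcode_cons codeAs ffunE prvK supp.
  by case: (c j).
- case=> [_|Y Ys [/= Yne [[|w ws] //= remw peelw]]].
    by right; rewrite Order.SeqLexiOrder.ltxi0s.
  case/andP: remw => remw remws; case/andP: Yne => Yne Ysne.
  move: peelw; rewrite peel_cat; case E: (peel w c) => [d|] //= peelws.
  have subYA : Y \subset A.
    apply/fintype.subsetP => j Yj; rewrite supp.
    exact: (peel_removal_sub remw E Yj).
  have [eqYA|neYA] := eqVneq Y A; last first.
    right; rewrite /card_seq /= Order.SeqLexiOrder.ltxi_cons.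
    have : (#|Y| < #|A|)%N by apply: proper_card; rewrite finset.properEneq neYA.
    by rewrite leEnat => ltYA; rewrite ltnW //= leqNgt ltYA.
  have -> : Y = A by [].
  have d1 : d = c1.
    by move: E; rewrite (peel_support _ remw) ?eqYA // => -[].
  rewrite {}d1 in peelws.
  have [|->|ltYs] := maxAs Ys; [by split=> //; exists ws | by left|right].
  by rewrite /card_seq /= Order.SeqLexiOrder.ltxi_cons lexx /= ltYs.
case: decAs => neAs [vs remvs peelvs]; split.
  rewrite /= neAs /nonempty_proper propA !andbT.
  by apply/set0Pn; exists i; rewrite supp.
exists (v :: vs); first by rewrite /= remv.
by rewrite /= peel_cat peelv.
Qed.

End Codes.

(** * Affine permutations and their inversion codes *)

Section AffineFunctions.
Variable k : nat.
Hypothesis hk : (1 <= k)%N.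
Local Notation I := 'I_k.+1.
Local Notation n := (k.+1)%:Z.
Local Notation s := (@simple_refl k).

Lemma eqmodP (p q : int) :
  reflect (exists m : int, p = q + m * n) (p == q %[mod n])%Z.
Proof.
rewrite eqz_mod_dvd; apply: (iffP dvdzP) => -[m pq]; exists m; lia.
Qed.

Lemma eqmod_ord (i j : I) : (i%:Z == j%:Z %[mod n])%Z = (i == j).
Proof.
by rewrite !modz_nat !modn_small.
Qed.

Lemma ordS_mod (i : I) : ((ordS i)%:Z == i%:Z + 1 %[mod n])%Z.
Proof. by rewrite /= -modz_nat modz_mod -addn1 PoszD. Qed.

Lemma ord_pred_mod (i : I) : ((ord_pred i)%:Z == i%:Z - 1 %[mod n])%Z.
Proof.
by rewrite -(eqz_modDr 1) subrK eq_sym -{1}(ord_predK i) ordS_mod.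
Qed.

Lemma ord_mod (z : int) : exists i : I, (z == i%:Z %[mod n])%Z.
Proof.
have lt_z : (`|(z %% n)%Z| < k.+1)%N.
  by have := ltz_pmod z (isT : 0 < n); have := modz_ge0 z (isT : n != 0); lia.
exists (Ordinal lt_z); rewrite /= gez0_abs ?modz_mod //.
exact: modz_ge0.
Qed.

Lemma mod_succ_neq (z : int) : (z + 1 == z %[mod n])%Z = false.
Proof.
rewrite -[X in (_ == X %[mod _])%Z]addr0 (addrC z 1) (addrC z) eqz_modDr.
by rewrite !modz_small //; lia.
Qed.

Lemma refl_lo (i : I) z : (z == i%:Z %[mod n])%Z -> s i z = z + 1.
Proof. by rewrite /simple_refl => ->. Qed.

Lemma refl_hi (i : I) z : (z == i%:Z + 1 %[mod n])%Z -> s i z = z - 1.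
Proof.
rewrite /simple_refl => zi; rewrite zi; case: ifP => // zi'.
by have := mod_succ_neq i%:Z; rewrite -(eqP zi) (eqP zi') eqxx.
Qed.

Lemma refl_fix (i : I) z : (z == i%:Z %[mod n])%Z = false ->
  (z == i%:Z + 1 %[mod n])%Z = false -> s i z = z.
Proof. by rewrite /simple_refl => -> ->. Qed.

Lemma reflK i : involutive (s i).
Proof.
move=> z; case E: (z == i%:Z %[mod n])%Z.
  by rewrite (refl_lo E) refl_hi ?addrK // eqz_modDr.
case E': (z == i%:Z + 1 %[mod n])%Z; last by rewrite !refl_fix.
by rewrite (refl_hi E') refl_lo ?subrK // -(eqz_modDr 1) subrK.
Qed.

Lemma refl_shift i z : s i (z + n) = s i z + n.
Proof.
rewrite /simple_refl !modzDr.
by case: ifP => _; [|case: ifP => _]; rewrite ?(addrAC z n).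
Qed.

(** Points move by at most one, so only an exchanged adjacent pair can change its order. *)
Lemma refl_lt i (j z : int) : j < z -> s i j != z -> s i j < s i z.
Proof.
move=> lt_jz ne.
have ne_s : s i j != s i z by rewrite (inj_eq (inv_inj (reflK i))) lt_eqF.
have ne' : s i z != j by apply: contraNneq ne => <-; rewrite reflK.
move: ne ne' ne_s; rewrite /simple_refl.
by do 2![case: ifP => _]; do 2?[case: ifP => _]; lia.
Qed.

(** The displacement [f z - z] depends only on the residue of [z], so normalizing its sum over
    [0, ..., k] amounts to the condition on the window [1, ..., k+1]. *)
Record aff (f : int -> int) : Prop := Aff {
  aff_bij : exists g, cancel f g /\ cancel g f;
  aff_shift : forall z, f (z + n) = f z + n;
  aff_sum : \sum_(r : I) (f r%:Z - r%:Z) = 0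
}.

Lemma aff_inj f : aff f -> injective f.
Proof. by case=> [[g [fK _]]] _ _; exact: can_inj fK. Qed.

Lemma aff_shiftM f (z m : int) : aff f -> f (z + m * n) = f z + m * n.
Proof.
move=> aff_f; elim: m => [|m IHm|m IHm]; first by rewrite mul0r !addr0.
  by rewrite intS mulrDl mul1r addrCA addrC aff_shift // IHm; lia.
apply: (addIr n); rewrite -aff_shift // -!addrA.
have -> : - m.+1%:Z * n + n = - m%:Z * n by lia.
exact: IHm.
Qed.

Lemma aff_mod f (z w : int) :
  aff f -> (z == w %[mod n])%Z -> f z - z = f w - w.
Proof. by move=> aff_f /eqmodP[m ->]; rewrite aff_shiftM //; lia. Qed.

Lemma aff_refl f i : aff f -> aff (f \o s i).
Proof.
move=> aff_f; split.
- have [g [fK gK]] := aff_bij aff_f; exists (s i \o g).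
  by split=> z /=; rewrite ?fK ?reflK ?gK.
- by move=> z /=; rewrite refl_shift aff_shift.
have nSi : ordS i != i.
  by rewrite -eqmod_ord (eqP (ordS_mod i)) mod_succ_neq.
rewrite -[RHS](aff_sum aff_f) (bigD1 i) // [RHS](bigD1 i) //=.
rewrite (bigD1 (ordS i)) // [in RHS](bigD1 (ordS i)) //= refl_lo //.
rewrite refl_hi ?ordS_mod //.
rewrite (eq_bigr (fun r : I => f r%:Z - r%:Z)) => [|r /andP[/negPf ri /negPf rSi]];
  last by rewrite refl_fix ?eqmod_ord // -(eqP (ordS_mod i)) eqmod_ord.
(* [ordS i] may wrap around to 0 and differ from [i + 1], but the displacements at congruent points
   agree. *)
have /= E1 := aff_mod aff_f (ordS_mod i).
have E2 : f ((ordS i)%:Z - 1) - ((ordS i)%:Z - 1) = f i%:Z - i%:Z.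
  by apply: aff_mod => //; rewrite -(eqz_modDr 1) subrK ordS_mod.
move: E1 E2 => /=; lia.
Qed.

Lemma aff_id : aff id.
Proof.
split; [by exists id | by [] |].
by rewrite big1 // => r _; rewrite subrr.
Qed.

Lemma aff_comp_word f (w : seq I) : aff f -> aff (f \o word_perm w).
Proof.
elim: w f => //= i w IHw f aff_f.
exact: (IHw _ (aff_refl i aff_f)).
Qed.

Lemma aff_word (w : seq I) : aff (word_perm w).
Proof. exact: (aff_comp_word w aff_id). Qed.

(** * Inversion codes and their behaviour under a simple reflection *)

Section FunctionCode.
Variable b : bool.

(* For [b = true] the sets below count larger values to the left (RD, LI), for
   [b = false] smaller values to the right (RI, LD). *)
Definition blt (x y : int) : bool := if b then x < y else y < x.

Definition invset (f : int -> int) (p : int) : set int :=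
  [set j : int | blt j p /\ blt (f p) (f j)]%classic.

Definition cnt (f : int -> int) (p : int) : nat := #|` fset_set (invset f p)|%fset.

(** The offset [b] puts the count at position [i + 1] for larger values to the left and at position
    [i] for smaller values to the right. *)
Definition pcode (f : int -> int) : {ffun I -> nat} :=
  [ffun i : I => cnt f (i%:Z + b%:Z)].

Lemma blt_trans x y z : blt x y -> blt y z -> blt x z.
Proof. by rewrite /blt; case: b; lia. Qed.

Lemma blt_asym x y : blt x y -> blt y x = false.
Proof. by rewrite /blt; case: b; lia. Qed.

(** Displacements are periodic, hence bounded by some [M], and an inversion partner of [p] lies
    within distance [2 * M] of it. *)
Lemma finite_invset f p : aff f -> finite_set (invset f p).
Proof.
move=> aff_f.
pose M : nat := \max_(r : I) `|f r%:Z - r%:Z|%N.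
have bound z : `|f z - z| <= M%:Z.
  have [r zr] := ord_mod z; rewrite (aff_mod aff_f zr).
  have := @leq_bigmax I (fun r : I => `|f r%:Z - r%:Z|%N) r.
  by rewrite -/M; lia.
apply: (@sub_finite_set _ _
  ((fun m : nat => p - (2 * M)%:Z + m%:Z) @` `I_(4 * M).+1)%classic).
  move=> j [] jp fjp; have bj := bound j; have bp := bound p.
  exists (absz (j - p + (2 * M)%:Z)%R) => /=; move: jp fjp; rewrite /blt; case: b; lia.
exact/finite_image/finite_II.
Qed.

Lemma card_fset_image (h : int -> int) (A : set int) : injective h ->
  finite_set A -> #|` fset_set (h @` A)%classic|%fset = #|` fset_set A|%fset.
Proof.
move=> inj_h finA; rewrite fset_set_image //.
by rewrite card_imfset.
Qed.

Lemma cnt_mod f p q : aff f -> (p == q %[mod n])%Z -> cnt f p = cnt f q.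
Proof.
move=> aff_f /eqmodP[m ->]; rewrite /cnt.
rewrite -(@card_fset_image (fun z => z + m * n) (invset f q));
  [|exact: addIr|exact: finite_invset].
congr #|` fset_set _|%fset; apply/seteqP; split=> j /=.
  move=> [jq fjq]; exists (j - m * n); last by rewrite subrK.
  have := aff_shiftM (j - m * n) m aff_f; rewrite subrK => fj.
  move: jq fjq; rewrite fj aff_shiftM // /invset /blt /=; case: b; lia.
move=> [l [lq flq] <-]; move: lq flq; rewrite /invset /= !aff_shiftM // /blt.
by case: b; lia.
Qed.

Lemma refl_blt (i : I) (j z : int) : blt j z -> s i j != z -> blt (s i j) (s i z).
Proof.
rewrite /blt; case: b => [|lt_zj ne]; first exact: refl_lt.
by apply: refl_lt => //; apply: contraNneq ne => <-; rewrite reflK.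
Qed.

(** The reflection keeps the order of every pair of positions except the exchanged one, and the
    hypothesis ensures that this pair does not contribute at [s i z] after the exchange. *)
Lemma invset_refl f (i : I) z :
    (blt z (s i z) -> blt (f (s i z)) (f z)) ->
  invset (f \o s i) (s i z) = (s i @` (invset f z `\ s i z))%classic.
Proof.
move=> des; apply/seteqP; split=> [j|_ [l [[lz fl] lNsz] <-]].
  rewrite /invset /= reflK => -[jz fjz].
  have ne_sj : s i j != s i z.
    apply: contraTneq fjz => /(inv_inj (reflK i)) eq_jz.
    by rewrite eq_jz in jz *; rewrite blt_asym ?des.
  exists (s i j); last by rewrite reflK.
  split; last by apply/eqP.
  by split=> //; have := refl_blt jz ne_sj; rewrite reflK.
rewrite /invset /= !reflK; split=> //; apply: refl_blt => //.
by apply: contra_notN lNsz => /eqP<-; rewrite reflK.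
Qed.

Lemma cnt_refl f (i : I) z : aff f ->
    (blt z (s i z) -> blt (f (s i z)) (f z)) ->
  cnt f z = (cnt (f \o s i) (s i z) + (blt (s i z) z && blt (f z) (f (s i z))))%N.
Proof.
move=> aff_f des; rewrite /cnt invset_refl // card_fset_image; last first.
- exact/finite_setD/finite_invset.
- exact: inv_inj (reflK i).
rewrite fset_setD1; last exact: finite_invset.
rewrite [LHS](cardfsD1 (s i z)) addnC; congr (_ + nat_of_bool _)%N.
rewrite in_fset_set; last exact: finite_invset.
by apply/idP/andP => [/set_mem|?]; [|exact/mem_set].
Qed.

(* [c i] is the count at [hi] and [c (prv i)] the count at [lo], where
   {lo, hi} = {i, i + 1} are the two positions exchanged by the letter [i]. *)
Lemma pcode_peel f (i : I) : aff f -> f (i%:Z + 1) < f i%:Z ->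
  peel1 b i (pcode f) = Some (pcode (f \o s i)).
Proof.
move=> aff_f des.
have aff_g := aff_refl i aff_f.
pose hi : int := i%:Z + b%:Z; pose lo : int := i%:Z + (~~ b)%:Z.
have [s_hi s_lo] : s i hi = lo /\ s i lo = hi.
  have s0 : s i i%:Z = i%:Z + 1 by rewrite refl_lo.
  have s1 : s i (i%:Z + 1) = i%:Z by rewrite refl_hi ?addrK.
  by rewrite /hi /lo; case: b => /=; rewrite !addr0.
have lt_lohi : blt lo hi by rewrite /blt /lo /hi; case: b => /=; lia.
have lt_f : blt (f hi) (f lo).
  by move: des; rewrite /blt /lo /hi; case: b; rewrite /= addr0.
have c_hi : cnt f hi = (cnt (f \o s i) lo).+1.
  have := @cnt_refl f i hi aff_f; rewrite s_hi lt_lohi lt_f (blt_asym lt_lohi).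
  by rewrite addn1; apply.
have c_lo : cnt f lo = cnt (f \o s i) hi.
  have := @cnt_refl f i lo aff_f; rewrite s_lo lt_f (blt_asym lt_lohi).
  by rewrite addn0; apply.
have prv_mod : ((prv b i)%:Z + b%:Z == lo %[mod n])%Z.
  rewrite /prv /lo; case: b => /=; rewrite addr0.
    by have := ord_pred_mod i; rewrite -(eqz_modDr 1) subrK.
  exact: ordS_mod.
have modhi (j : I) : (j%:Z + b%:Z == hi %[mod n])%Z = (j == i).
  by rewrite eqz_modDr eqmod_ord.
(* By transitivity every inversion counted at [lo] is also counted at [hi], where [lo] itself is one
   more. *)
have lt_c : (cnt f lo < cnt f hi)%N.
  rewrite /cnt [X in (_ < X)%N](cardfsD1 lo) in_fset_set; last exact: finite_invset.
  have -> : lo \in invset f hi by exact/mem_set.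
  rewrite ltnS -fset_setD1; last exact: finite_invset.
  apply: fsubset_leq_card; rewrite -fset_set_sub; first last.
  - exact/finite_setD/finite_invset.
  - exact: finite_invset.
  move=> j [jlo fj]; split; last first.
    by move=> ejlo; move: jlo; rewrite ejlo /blt; case: b; rewrite ltxx.
  by split; [exact: blt_trans lt_lohi | exact: blt_trans fj].
rewrite /peel1 !ffunE (cnt_mod _ prv_mod) // lt_c; congr Some; apply/ffunP => j.
rewrite !ffunE; case: eqVneq => [->|ji]; first exact: c_lo.
case: eqVneq => [->|jpi]; first by rewrite (cnt_mod _ prv_mod) // c_hi.
have s_j : s i (j%:Z + b%:Z) = j%:Z + b%:Z.
  have : (j%:Z + b%:Z == lo %[mod n])%Z = false.
    by rewrite -(eqP prv_mod) eqz_modDr eqmod_ord (negPf jpi).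
  have : (j%:Z + b%:Z == hi %[mod n])%Z = false by rewrite modhi (negPf ji).
  by rewrite /lo /hi; case: b => /=; rewrite !addr0 => ? ?; exact: refl_fix.
have := @cnt_refl f i _ aff_f; rewrite -[in RHS]s_j => ->.
  by rewrite s_j /blt; case: b; rewrite ltxx addn0.
by rewrite s_j /blt; case: b; rewrite ltxx.
Qed.

(** By injectivity exactly one of [f] and [f \o s i] has a descent at [i]. A peel leaves at [prv i]
    an entry at least as large as the one at [i], so it cannot be repeated at once. *)
Lemma pcode_dichotomy f (i : I) : aff f ->
     peel1 b i (pcode f) = Some (pcode (f \o s i))
  \/ peel1 b i (pcode f) = None /\
     peel1 b i (pcode (f \o s i)) = Some (pcode f).
Proof.
move=> aff_f; have /orP[lt_f|lt_f] : (f (i%:Z + 1) < f i%:Z) || (f i%:Z < f (i%:Z + 1)).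
- by rewrite -neq_lt (inj_eq (aff_inj aff_f)); lia.
- by left; exact: pcode_peel.
right.
have peel_g : peel1 b i (pcode (f \o s i)) = Some (pcode f).
  rewrite pcode_peel; [|exact: aff_refl|].
    by congr (Some (pcode _)); apply/funext => z /=; rewrite reflK.
  by rewrite /= [s i (_ + 1)]refl_hi // refl_lo // addrK.
split=> //; move: (pcode _) (pcode f) peel_g => d c.
rewrite /peel1; case: ltnP => // lt_g [<-].
rewrite !ffunE !eqxx; case: eqVneq => [e|_]; first by rewrite e ltnn in lt_g.
by case: ltnP => //; lia.
Qed.

(** Without inversions [f] is an increasing bijection of the integers, hence a translation, and the
    sum condition makes the translation trivial. *)
Lemma pcode_eq0 f : aff f -> pcode f = [ffun=> 0%N] -> f = id.
Proof.
move=> aff_f code0.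
have cnt0 p : cnt f p = 0%N.
  have [i pi] := ord_mod (p - b%:Z); have := congr1 (fun c : {ffun _} => c i) code0.
  rewrite !ffunE => <-; apply: cnt_mod => //.
  by rewrite -[p](subrK b%:Z) eqz_modDr.
have le_f j p : blt j p -> blt (f j) (f p).
  move=> lt_jp; have : ~~ blt (f p) (f j).
    apply/negP => lt_f; have := cnt0 p; rewrite /cnt (cardfsD1 j) in_fset_set.
      by rewrite mem_set.
    exact: finite_invset.
  have : f j != f p.
    rewrite (inj_eq (aff_inj aff_f)).
    by move: lt_jp; rewrite /blt; case: b; lia.
  by move: lt_jp; rewrite /blt; case: b; lia.
have inc_f j p : j < p -> f j < f p.
  by have := le_f j p; have := le_f p j; rewrite /blt; case: b => // H _; exact: H.
have succ_f z : f (z + 1) = f z + 1.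
  have lt_f := inc_f z (z + 1) ltac:(lia).
  have [//|ne] := eqVneq (f (z + 1)) (f z + 1).
  (* If the value [f z + 1] were skipped, its preimage would lie strictly between [z] and
     [z + 1]. *)
  have [g [fK gK]] := aff_bij aff_f; have fg := gK (f z + 1).
  have [lt_g|lt_g|eq_g] := ltgtP (g (f z + 1)) z.
  - by have := inc_f _ _ lt_g; lia.
  - have [lt_g'|lt_g'|eq_g] := ltgtP (g (f z + 1)) (z + 1).
    + by move: lt_g lt_g'; lia.
    + by have := inc_f _ _ lt_g'; lia.
    + by move: fg; rewrite eq_g; lia.
  - by move: fg; rewrite eq_g; lia.
have fE (m : nat) : f m%:Z - m%:Z = f 0.
  by elim: m => [|m IHm]; rewrite ?subr0 // -addn1 PoszD succ_f -IHm; lia.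
have f0 : f 0 = 0.
  have := aff_sum aff_f; under eq_bigr => r _ do rewrite fE.
  by rewrite sumr_const card_ord => /eqP; rewrite mulrn_eq0 => /eqP.
apply/funext => z; elim: z => [//|m IHm|m IHm] /=.
  by have := fE m.+1; rewrite f0; lia.
have := succ_f (- m.+1%:Z); have -> : - m.+1%:Z + 1 = - m%:Z by lia.
by rewrite IHm /=; lia.
Qed.

(** In a window of [k+1] consecutive positions take the greatest value (the least, for [b = false]).
    A value beyond it occurs only in a translate of the window on the wrong side. *)
Lemma pcode_has_zero f : aff f -> exists i : I, pcode f i = 0%N.
Proof.
move=> aff_f.
pose g (r : I) : int := if b then f (r%:Z + b%:Z) else - f (r%:Z + b%:Z).
have [i maxi] : exists i : I, forall j, g j <= g i.
  by case: (@arg_maxP _ _ I ord0 xpredT g isT) => i _ maxi; exists i => j; exact: maxi.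
exists i; rewrite ffunE /cnt; apply/eqP; rewrite cardfs_eq0; apply/eqP.
rewrite -fset_set0; congr fset_set; rewrite -subset0 => j [lt_j lt_fj] /=.
have [r jr] := ord_mod (j - b%:Z).
have [m jE] := eqmodP _ _ jr.
have {}jE : j = r%:Z + b%:Z + m * n by lia.
have := maxi r; move: lt_j lt_fj; rewrite jE aff_shiftM // /blt /g.
have := ltn_ord r; have := ltn_ord i.
case: b => /=; rewrite ?addr0 => li lr lt_j lt_fj le_g.
  have [m1|m0] := ltP 0 m.
    have : n <= m * n by rewrite ler_peMl.
    lia.
  have : m * n <= 0 by rewrite mulr_le0_ge0.
  lia.
have [m1|m0] := ltP m 0.
  have : n <= - m * n by rewrite ler_peMl //; lia.
  lia.
have : 0 <= m * n by rewrite mulr_ge0.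
lia.
Qed.
End FunctionCode.

(** * Commutation and braid relations of the simple reflections *)

Lemma mod_neq (a b : int) : 0 < `|a - b| <= k%:Z -> (a == b %[mod n])%Z = false.
Proof.
move=> /andP[ab0 abk]; apply/eqmodP => -[m abm].
have m0 : m != 0 by apply: contraTneq ab0 => m0; rewrite abm m0 mul0r addr0 subrr.
have : n <= `|m| * n by rewrite ler_peMl //; lia.
have <- : `|a - b| = `|m| * n by rewrite abm addrC addKr normrM.
lia.
Qed.

Lemma refl_comm (i j : I) : j \notin [:: ord_pred i; i; ordS i] ->
  s i \o s j = s j \o s i.
Proof.
rewrite !inE !negb_or => /and3P[jpi ji jSi].
(* The two exchanged pairs of residues are disjoint, so a point moved by one reflection is fixed by
   the other, before and after its move. *)
have half (a b : I) z : a != b -> a != ordS b -> b != ordS a ->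
    (z == a%:Z %[mod n])%Z || (z == a%:Z + 1 %[mod n])%Z ->
    s a (s b z) = s b (s a z).
  move=> ab aSb bSa.
  have fa (z' : int) : (z' == a%:Z %[mod n])%Z -> s b z' = z'.
    move=> z'a; rewrite refl_fix // (eqP z'a) ?eqmod_ord ?(negPf ab) //.
    by rewrite -(eqP (ordS_mod b)) eqmod_ord (negPf aSb).
  have fSa (z' : int) : (z' == a%:Z + 1 %[mod n])%Z -> s b z' = z'.
    move=> z'a; rewrite refl_fix // (eqP z'a) ?eqz_modDr ?eqmod_ord ?(negPf ab) //.
    by rewrite -(eqP (ordS_mod a)) eqmod_ord eq_sym (negPf bSa).
  case/orP=> za.
    by rewrite fa // refl_lo // fSa // eqz_modDr.
  by rewrite fSa // refl_hi // fa // -(eqz_modDr 1) subrK.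
have iSj : i != ordS j by rewrite -(inj_eq (@ord_pred_inj k.+1)) ordSK eq_sym.
apply/funext => z /=.
case zi : ((z == i%:Z %[mod n])%Z || (z == i%:Z + 1 %[mod n])%Z).
  by apply: half; rewrite // eq_sym.
case zj : ((z == j%:Z %[mod n])%Z || (z == j%:Z + 1 %[mod n])%Z).
  by rewrite (half j i).
move/norP: (negbT zi) => [/negPf zi0 /negPf zi1].
move/norP: (negbT zj) => [/negPf zj0 /negPf zj1].
by rewrite (refl_fix zi0 zi1) (refl_fix zj0 zj1) refl_fix.
Qed.

Lemma refl_shiftM (i : I) z m : s i (z + m * n) = s i z + m * n.
Proof.
by rewrite -(aff_shiftM z m (aff_word [:: i])).
Qed.

Lemma refl_braid (i : I) : (2 <= k)%N ->
  s i \o s (ordS i) \o s i = s (ordS i) \o s i \o s (ordS i).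
Proof.
move=> k2; set j := ordS i.
have jS (z : int) c : (z == j%:Z + c %[mod n])%Z = (z == i%:Z + (1 + c) %[mod n])%Z.
  by rewrite -modzDml (eqP (ordS_mod i)) modzDml addrA.
have jS0 (z : int) : (z == j%:Z %[mod n])%Z = (z == i%:Z + 1 %[mod n])%Z.
  by rewrite (eqP (ordS_mod i)).
have i0 : s i i%:Z = i%:Z + 1 by rewrite refl_lo.
have i1 : s i (i%:Z + 1) = i%:Z by rewrite refl_hi // addrK.
have j1 : s j (i%:Z + 1) = i%:Z + 2 by rewrite refl_lo ?jS0 // -addrA.
have j2 : s j (i%:Z + 2) = i%:Z + 1 by rewrite refl_hi ?jS //; lia.
have iF c : 2 <= c <= k%:Z -> s i (i%:Z + c) = i%:Z + c.
  by move=> ck; apply: refl_fix; apply: mod_neq; lia.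
have jF c : (c == 0) || (3 <= c <= k%:Z) -> s j (i%:Z + c) = i%:Z + c.
  by move=> ck; apply: refl_fix; rewrite ?jS ?jS0; apply: mod_neq; lia.
have j0 : s j i%:Z = i%:Z by have := jF 0; rewrite addr0; apply.
have i2 : s i (i%:Z + 2) = i%:Z + 2 by apply: iF; lia.
apply/funext => z /=.
(* By periodicity only the offset [c] of [z] from [i] modulo [n] matters: both sides reverse the
   offsets 0, 1, 2 and fix the rest. *)
have -> : z = i%:Z + ((z - i%:Z) %% n)%Z + ((z - i%:Z) %/ n)%Z * n.
  by rewrite -addrA [X in _ + X]addrC -divz_eq addrC subrK.
rewrite !refl_shiftM; congr (_ + _).
have c_ge0 := modz_ge0 (z - i%:Z) (isT : n != 0).
have c_lt := ltz_pmod (z - i%:Z) (isT : 0 < n).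
move: (_ %% _)%Z c_ge0 c_lt => c c_ge0 c_lt.
have [->|c0] := eqVneq c 0; first by rewrite addr0 i0 j0 j1 i0 i2 j1.
have [->|c1] := eqVneq c 1; first by rewrite i1 j0 i0 j1 i2 j2.
have [->|c2] := eqVneq c 2; first by rewrite i2 j2 i1 j0.
by do ![rewrite iF; last lia | rewrite jF; last lia].
Qed.

(** * Reduced words and the nil-Coxeter monoid *)

Lemma word_perm_cat (v w : seq I) : word_perm (v ++ w) = word_perm v \o word_perm w.
Proof. by elim: v => //= i v ->. Qed.

Lemma word_perm_rcons (w : seq I) i : word_perm (rcons w i) = word_perm w \o s i.
Proof. by rewrite -cats1 word_perm_cat. Qed.

Lemma word_perm_revK (w : seq I) : cancel (word_perm w) (word_perm (rev w)).
Proof.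
elim: w => [|i w IHw] z; first by [].
by rewrite rev_cons word_perm_rcons /= reflK IHw.
Qed.

Lemma reduced_eq (v w : seq I) : word_perm v = word_perm w -> size v = size w ->
  reduced v -> reduced w.
Proof. by move=> eq_vw sz red_v u uw; rewrite -sz; apply: red_v; rewrite eq_vw. Qed.

(** Being a reduced word of [f] is invariant under the relations: commutation and braid keep the
    length and the permutation, while a word with a square can be shortened and so, like [None], is
    never reduced. *)
Lemma nilcox_reduced (m1 m2 : option (seq I)) f : nilcox m1 m2 ->
  (exists w, [/\ m1 = Some w, reduced w & word_perm w = f]) <->
  (exists w, [/\ m2 = Some w, reduced w & word_perm w = f]).
Proof.
have same (v w : seq I) : word_perm v = word_perm w -> size v = size w ->
    (exists u, [/\ Some v = Some u, reduced u & word_perm u = f]) <->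
    (exists u, [/\ Some w = Some u, reduced u & word_perm u = f]).
  move=> eq_vw sz; split=> -[_ [[<-] red <-]].
    by exists w; split=> //; exact: reduced_eq red.
  by exists v; split=> //; exact: reduced_eq red.
elim=> {m1 m2} [//|m1 m2 _ IH|m1 m2 m3 _ IH1 _ IH2|p q i|p q i j far|p q i k2].
- by apply: iff_sym.
- exact: iff_trans IH1 IH2.
- split=> -[w [//]]; move=> [<-] red _; exfalso.
  have : (size (p ++ [:: i; i] ++ q) <= size (p ++ q))%N.
    apply: red => z; rewrite !word_perm_cat /=.
    by rewrite reflK.
  by rewrite !size_cat /=; lia.
- apply: same; last by rewrite !size_cat.
  rewrite !word_perm_cat; congr (_ \o (_ \o _)).
  exact: refl_comm.
- apply: same; last by rewrite !size_cat.
  rewrite !word_perm_cat; congr (_ \o (_ \o _)).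
  exact: refl_braid.
Qed.

Lemma representsP (v : seq I) (x : affine_perm k) :
  represents (Some v) x <-> reduced v /\ (x : int -> int) = word_perm v.
Proof.
split=> [[w [red_w xw nil]]|[red_v xv]].
  have [_ [|u [[->] red_u eu]]] := nilcox_reduced (word_perm w) nil.
    by exists w.
  by split=> //; rewrite eu; apply/funext.
exists v; split=> //; last exact: nilcox_refl.
by move=> z; rewrite xv.
Qed.

Lemma reduced_rev (w : seq I) : reduced w -> reduced (rev w).
Proof.
move=> red v vw; rewrite size_rev -(size_rev v); apply: red => z.
by rewrite -[in LHS](word_perm_revK w z) -vw word_perm_revK.
Qed.

Section ReducedWords.
Variable b : bool.

Lemma pcode_id : pcode b id = [ffun=> 0%N].
Proof.
apply/ffunP=> i; rewrite !ffunE /cnt; apply/eqP; rewrite cardfs_eq0; apply/eqP.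
rewrite -fset_set0; congr fset_set; rewrite -subset0 => j [] /=.
by move/blt_asym=> ->.
Qed.

(** Each letter changes the sum of the code by exactly one, up or down; this sum is the lower bound
    that certifies reducedness. *)
Lemma sum_pcode_le (w : seq I) : (\sum_i pcode b (word_perm w) i <= size w)%N.
Proof.
elim/last_ind: w => [|w i IHw].
  by rewrite [word_perm _]/= pcode_id big1 // => i _; rewrite ffunE.
rewrite word_perm_rcons size_rcons.
have [/peel1_sum|[_ /peel1_sum]] := pcode_dichotomy b i (aff_word w).
  by move: IHw; lia.
by move: IHw => /= IHw ->; lia.
Qed.

Lemma peel_pcode r f c : aff f -> peel b r (pcode b f) = Some c ->
  c = pcode b (f \o word_perm r).
Proof.
elim: r f c => [|i r IHr] f c aff_f; first by case.
rewrite peel_cons; have [->|[-> //]] := pcode_dichotomy b i aff_f.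
by move=> /(IHr _ _ (aff_refl i aff_f)).
Qed.

(** A word that peels the code to zero has length equal to the code sum, hence is minimal.
    Conversely the last letter of a reduced word is a descent, as otherwise a shorter word would
    exist. *)
Lemma peel_reducedP r f : aff f ->
  peel b r (pcode b f) = Some [ffun=> 0%N] <->
  reduced (rev r) /\ f = word_perm (rev r).
Proof.
have peel_id g t : aff g -> peel b t (pcode b g) = Some [ffun=> 0%N] ->
    g = word_perm (rev t).
  move=> aff_g /(peel_pcode aff_g)/esym code0.
  have aff_gt := aff_comp_word t aff_g.
  have gt := pcode_eq0 aff_gt code0; apply/funext => z.
  rewrite -[in LHS](word_perm_revK (rev t) z) revK.
  by rewrite -[LHS]/((g \o word_perm t) _) gt.
move=> aff_f; split=> [peel_r|[]].
  have fr := peel_id f r aff_f peel_r; split=> // v vr.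
  have := peel_sum peel_r; rewrite [X in (X + _)%N]big1 ?add0n => [|i _];
    last by rewrite ffunE.
  rewrite size_rev => <-; rewrite fr.
  rewrite -(_ : word_perm v = word_perm (rev r)) ?sum_pcode_le //.
  exact/funext.
elim: r f aff_f => [|i r IHr] f aff_f red_r fr.
  by rewrite fr /peel /= pcode_id.
rewrite rev_cons in red_r fr; rewrite peel_cons.
have gr : f \o s i = word_perm (rev r).
  by rewrite fr word_perm_rcons; apply/funext=> z /=; rewrite reflK.
have red_g : reduced (rev r).
  move=> v vr; have := red_r (rcons v i); rewrite !size_rcons; apply=> z.
  by rewrite !word_perm_rcons /= vr.
have {}IHr := IHr _ (aff_refl i aff_f) red_g gr.
have [->//|[_ peel_g]] := pcode_dichotomy b i aff_f; exfalso.
(* The greedy decomposition supplies a word for [f] whose length is the code sum, two letters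
   shorter than the given one. *)
have [As [[_ [vs _ peel_vs]] _ _]] := greedy_decomposition b (pcode_has_zero b aff_f).
have sum0 : (\sum_(j : I) [ffun=> 0%N] j = 0)%N.
  by rewrite big1 // => j _; rewrite ffunE.
have sum_f := peel_sum peel_vs; have sum_g := peel_sum IHr.
have sum_fg := peel1_sum peel_g.
have := red_r (rev (flatten vs)).
rewrite -(peel_id _ _ aff_f peel_vs) -fr => /(_ (fun=> erefl)).
by move: sum_f sum_g sum_fg; rewrite sum0 size_rev size_rcons size_rev; lia.
Qed.
End ReducedWords.

(** * Canonical decompositions *)

Lemma index_rev_lt (T : eqType) (w : seq T) i j : uniq w -> i \in w -> j \in w ->
  (index i (rev w) < index j (rev w))%N = (index j w < index i w)%N.
Proof.
have index_rev a : uniq w -> a \in w -> index a (rev w) = (size w - (index a w).+1)%N.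
  move=> Uw aw; have lt_a : (index a w < size w)%N by rewrite index_mem.
  have nth_a : nth a (rev w) (size w - (index a w).+1) = a.
    rewrite nth_rev; last by lia.
    have -> : (size w - (size w - (index a w).+1).+1 = index a w)%N by lia.
    exact: nth_index.
  by rewrite -{1}nth_a index_uniq ?rev_uniq // size_rev; lia.
move=> Uw iw jw; rewrite !index_rev //.
by have := index_mem i w; have := index_mem j w; rewrite iw jw; lia.
Qed.

Lemma dec_word_rev (A : {set I}) w : dec_word A (rev w) = inc_word A w.
Proof.
rewrite /dec_word /inc_word rev_uniq; case: (boolP (uniq w)) => //= Uw.
have -> : [set i in rev w] = [set i in w] by apply/setP=> i; rewrite !inE mem_rev.
case: eqP => //= defA; apply: eq_forallb_in => j Aj.
have [Apj|//] := boolP (ord_pred j \in A).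
by rewrite /= index_rev_lt //; [move: Aj|move: Apj]; rewrite -defA inE.
Qed.

Lemma dec_word_removal (A : {set I}) w : dec_word A w = removal false A w.
Proof.
rewrite /dec_word /removal /prv; congr [&& _, _ & _].
apply/forall_inP/forall_inP => H j Aj; apply/implyP => Aj'.
  by have := H _ Aj'; rewrite ordSK Aj.
by have := H _ Aj'; rewrite ord_predK Aj.
Qed.

Lemma aff_perm (x : affine_perm k) : aff x.
Proof.
split; [by exists (ap_inv x); split; [exact: ap_funK|exact: ap_invK]|exact: ap_shift|].
have sum_ord : \sum_(r : I) r%:Z = ('C(k.+1, 2))%:Z.
  by rewrite -bin2_sum big_mkord -(big_morph Posz PoszD (erefl _)).
(* Moving the window from [1, ..., k+1] to [0, ..., k] lowers the sum by [n], the difference of the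
   two binomial coefficients. *)
have shift0 : x k.+1%:Z = x 0%:Z + n by rewrite -ap_shift add0r.
have := ap_sum x; rewrite big_nat_recr //= shift0.
rewrite sumrB sum_ord -(big_mkord xpredT (fun r => x r%:Z)).
rewrite [\sum_(0 <= _ < _) _]big_ltn //.
rewrite binS bin1 PoszD addrA => /addIr sum_x.
by apply/eqP; rewrite subr_eq0 addrC sum_x.
Qed.

Lemma word_inv (x : affine_perm k) (w : seq I) :
  (x : int -> int) = word_perm w <-> ap_inv x = word_perm (rev w).
Proof.
split=> xw; apply/funext => z.
  apply: (can_inj (ap_funK x)); rewrite ap_invK xw.
  by have := word_perm_revK (rev w) z; rewrite revK.
apply: (can_inj (ap_invK x)); rewrite ap_funK xw word_perm_revK.
by [].
Qed.

(** The greedy decomposition writes [x] as a word in the reflections, and the inverse is then the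
    reversed word. *)
Lemma aff_inv (x : affine_perm k) : aff (ap_inv x).
Proof.
have [As [[_ [vs _ peel_vs]] _ _]] :=
  greedy_decomposition true (pcode_has_zero true (aff_perm x)).
have [_ xw] := (peel_reducedP _ _ (aff_perm x)).1 peel_vs.
by rewrite ((word_inv x _).1 xw); exact: aff_word.
Qed.

Lemma all2_rev T1 T2 (r : T1 -> T2 -> bool) s1 s2 :
  all2 r (rev s1) (rev s2) = all2 r s1 s2.
Proof.
rewrite !all2E !size_rev; case: eqP => //= sz.
by rewrite -rev_zip // all_rev.
Qed.

Lemma all2_mapr T1 T2 T3 (r : T1 -> T3 -> bool) (h : T2 -> T3) s1 s2 :
  all2 r s1 (map h s2) = all2 (fun a c => r a (h c)) s1 s2.
Proof. by elim: s1 s2 => [|a s1 IHs] [|c s2] //=; rewrite IHs. Qed.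

(** Cancelling from the right reads the product backwards, so both the list of factors and each
    factor are reversed. *)
Lemma right_decomposes b P (x : affine_perm k) As :
    (forall A w, P A w = removal b A (rev w)) ->
  decomposition P x (rev As) <-> decomposes b (pcode b x) As.
Proof.
move=> PE; rewrite /decomposition /decomposes all_rev.
have all2E ws : all2 P (rev As) ws = all2 (removal b) As (map rev (rev ws)).
  rewrite all2_mapr -[ws in LHS]revK all2_rev.
  by elim: As (rev ws) => [|A As' IH] [|w ws'] //=; rewrite PE IH.
have flatE (ws : seq (seq I)) : flatten (map rev (rev ws)) = rev (flatten ws).
  by rewrite rev_flatten map_rev.
split=> -[ne q]; split=> //.
  have [ws Pws /representsP rep] := q.
  exists (map rev (rev ws)); first by rewrite -all2E.
  by rewrite flatE; apply/peel_reducedP; [exact: aff_perm | rewrite revK].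
have [vs remv peelv] := q.
have vsE : vs = map rev (rev (rev (map rev vs))).
  by rewrite revK -map_comp map_id_in // => v _ /=; rewrite revK.
exists (rev (map rev vs)); first by rewrite all2E -vsE.
apply/representsP; rewrite vsE flatE in peelv.
by move: peelv => /(peel_reducedP _ _ (aff_perm x)); rewrite revK.
Qed.

(** Cancelling from the left of [x] is cancelling from the right of its inverse, so here nothing is
    reversed. *)
Lemma left_decomposes b P (x : affine_perm k) Cs :
    (forall A w, P A w = removal b A w) ->
  decomposition P x Cs <-> decomposes b (pcode b (ap_inv x)) Cs.
Proof.
move=> PE; have all2E ws : all2 P Cs ws = all2 (removal b) Cs ws.
  by elim: Cs ws => [|C Cs' IH] [|w ws'] //=; rewrite PE IH.
have repE w : represents (Some w) x <->
    peel b w (pcode b (ap_inv x)) = Some [ffun=> 0%N].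
  split=> [/representsP[red /word_inv xw]|].
    by apply/peel_reducedP; [exact: aff_inv | split=> //; exact: reduced_rev].
  move=> /(peel_reducedP _ _ (aff_inv x))[red /word_inv xw].
  by apply/representsP; split=> //; rewrite -(revK w); exact: reduced_rev.
by split=> -[ne [ws Pws /repE rep]]; split=> //; exists ws; rewrite // ?all2E // -all2E.
Qed.

(** Every other decomposition is strictly smaller than the greedy one, so the choice operator can
    only return the latter. *)
Lemma lex_max_code b (c : {ffun I -> nat}) (Q : seq {set I} -> Prop) :
    (exists i, c i = 0%N) -> (forall Xs, Q Xs <-> decomposes b c Xs) ->
  kcode b (xget [::] (lex_max Q)) =1 c.
Proof.
move=> c0 QE; have [As [decAs maxAs codeAs]] := greedy_decomposition b c0.
have lexAs : lex_max Q As.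
  split=> [|Ys /QE/maxAs[->|/ltW]] //; exact/QE.
have [QX maxX] : lex_max Q (xget [::] (lex_max Q)) by apply: xgetPex; exists As.
have [->//|ltX] := maxAs _ ((QE _).1 QX).
by have := lt_le_trans ltX (maxX _ (lexAs.1)); rewrite ltxx.
Qed.

Lemma card_invset (b : bool) f (p : int) (i : I) (m : nat) : aff f -> p = i%:Z + b%:Z ->
  m = pcode b f i -> (invset b f p #= `I_m)%card.
Proof.
move=> aff_f -> ->; rewrite ffunE /cnt.
have fin := finite_invset b (i%:Z + b%:Z) aff_f.
by rewrite -[X in (X #= _)%card](fset_setK fin); apply/card_eq_fsetP.
Qed.

(** Inversions of the inverse are indexed by values of [x]; the bijection [x] re-indexes them by
    positions. *)
Lemma card_invset_inv b (x : affine_perm k) (p : int) (A : set int) (m : nat) :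
    A = [set j : int | blt b (x j) p /\ blt b (ap_inv x p) j]%classic ->
  (invset b (ap_inv x) p #= `I_m)%card -> (A #= `I_m)%card.
Proof.
move=> ->.
have <- : (x @` [set j : int | blt b (x j) p /\ blt b (ap_inv x p) j])%classic
    = invset b (ap_inv x) p.
  apply/seteqP; split=> [_ [j [xj jp] <-]|j [jp pj]]; first by split; rewrite ?ap_funK.
  by exists (ap_inv x j); rewrite /= ?ap_invK.
apply: card_eq_trans; rewrite card_eq_sym; apply: inj_card_eq => ? ? _ _.
exact: can_inj (ap_funK x) _ _.
Qed.

End AffineFunctions.

(* [A #= `I_n] says that the set A is finite with exactly n elements. *)
Theorem proposition49 (k : nat) (hk : (1 <= k)%N) (x : affine_perm k)
    (i : 'I_k.+1) :
  [/\ ([set j : int | j < i%:Z + 1 /\ x j > x (i%:Z + 1)]%classic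
         #= `I_(RD x i))%card,
      ([set j : int | j > i%:Z /\ x j < x i%:Z]%classic
         #= `I_(RI x i))%card,
      ([set j : int | j < ap_inv x i%:Z /\ x j > i%:Z]%classic
         #= `I_(LD x i))%card &
      ([set j : int | j > ap_inv x (i%:Z + 1) /\ x j < i%:Z + 1]%classic
         #= `I_(LI x i))%card].
Proof.
have aff_x := aff_perm x; have aff_i := aff_inv hk x.
(* The orientation is [true] for RD and LI, whose codes step down, and [false] for RI and LD; right
   codes use [x] and left codes its inverse. *)
have RDE : RD x i = pcode k true x i.
  apply: (@lex_max_code _ true) => [|As]; first exact: pcode_has_zero.
  apply: right_decomposes => // A w.
  by rewrite -[w in LHS]revK dec_word_rev.
have RIE : RI x i = pcode k false x i.
  apply: (@lex_max_code _ false) => [|As]; first exact: pcode_has_zero.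
  apply: right_decomposes => // A w.
  by rewrite -dec_word_removal dec_word_rev.
have LDE : LD x i = pcode k false (ap_inv x) i.
  apply: (@lex_max_code _ false) => [|As]; first exact: pcode_has_zero.
  apply: left_decomposes => // A w.
  exact: dec_word_removal.
have LIE : LI x i = pcode k true (ap_inv x) i.
  apply: (@lex_max_code _ true) => [|As]; first exact: pcode_has_zero.
  by apply: left_decomposes.
have eq1 : i%:Z + 1 = i%:Z + true%:Z by [].
have eq0 : i%:Z = i%:Z + false%:Z by rewrite addr0.
split.
- by have := card_invset hk aff_x eq1 RDE; exact.
- by have := card_invset hk aff_x eq0 RIE; exact.
- apply: (card_invset_inv _ (card_invset hk aff_i eq0 LDE)).
  by apply/seteqP; split=> j [].
- apply: (card_invset_inv _ (card_invset hk aff_i eq1 LIE)).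
  by apply/seteqP; split=> j [].
Qed.
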